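(* Let $\eta\in(1,\infty)$, let $G$ be a subgroup of $\mathbb{R}$ with $\mathbb{Z}\subseteq G$, and let $(K,v)$ be a separable complete valued field. Assume that $v(K\setminus\{0\})=G$ and that the residue field of $(K,v)$ is infinite. Put $R=\{0\}\cup\{\eta^{-g}\mid g\in G\}$. Then $K$ with the ultrametric $d(x,y)=\eta^{-v(x-y)}$ (with $\eta^{-\infty}=0$) is isometric to the $R$-Urysohn universal ultrametric space $(\mathbb{V}_R,\sigma_R)$.
   Context: A valued field $(K,v)$ is a field with a map $v\colon K\to\mathbb{R}\sqcup\{\infty\}$ such that $v(x)=\infty$ iff $x=0$, $v(xy)=v(x)+v(y)$, and $v(x+y)\ge\min\{v(x),v(y)\}$. Its residue field is $\{x\mid v(x)\ge0\}/\{x\mid v(x)>0\}$. Separability and completeness are with respect to the metric $\eta^{-v(x-y)}$. **Urysohn universal ultrametric spaces.** Metric spaces are nonempty. A range set is a subset $R\subseteq[0,\infty)$ with $0\in R$; a metric space is $R$-valued if all its distances lie in $R$. Let $\mathscr{N}(R)$ be the class of finite $R$-valued ultrametric spaces. A metric space $X$ is $\mathscr{N}(R)$-injective if for all $A,B\in\mathscr{N}(R)$ and isometric embeddings $\phi\colon A\to B$, $\psi\colon A\to X$ there is an isometric embedding $\theta\colon B\to X$ with $\theta\circ\phi=\psi$. If $R$ is countable, $(\mathbb{V}_R,\sigma_R)$ denotes the separable complete $R$-valued $\mathscr{N}(R)$-injective ultrametric space, which is unique up to isometry. If $R$ is uncountable, $(\mathbb{V}_R,\sigma_R)$ denotes the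 $R$-petaloid ultrametric space (unique up to isometry), defined as follows. A subset of $[0,\infty)$ is tenuous if it is finite or of the form $\{0\}\cup\{a_i\mid i\in\mathbb{Z}_{\ge0}\}$ with $(a_i)$ strictly decreasing in $(0,\infty)$ and $a_i\to0$. Let $\mathbf{TEN}(R)$ be the set of tenuous subsets of $R$ containing $0$. An $R$-valued ultrametric space $(X,d)$ is $R$-petaloid if there is a family $\{\Pi(X,S)\}_{S\in\mathbf{TEN}(R)}$ of subspaces of $X$ such that: (P1) each $(\Pi(X,S),d)$ is isometric to $(\mathbb{V}_S,\sigma_S)$ ($S$ being countable); (P2) $\bigcup_S\Pi(X,S)=X$; (P3) $\Pi(X,S)\cap\Pi(X,T)=\Pi(X,S\cap T)$ for all $S,T$; (P4) for $S,T\in\mathbf{TEN}(R)$ and $x\in\Pi(X,T)$, $d(x,\Pi(X,S))=\inf\{d(x,a)\mid a\in\Pi(X,S)\}$ belongs to $(T\setminus S)\cup\{0\}$. *)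

(* Defs.v *)
From HB Require Import structures.
From mathcomp Require Import all_boot all_order all_algebra ring_quotient ring lra.
From mathcomp Require Import all_classical all_reals all_analysis.

Set Implicit Arguments.
Unset Strict Implicit.
Unset Printing Implicit Defensive.

Import Order.TTheory GRing.Theory Num.Theory.
Import numFieldNormedType.Exports.

Local Open Scope classical_set_scope.
Local Open Scope ring_scope.

Section MetricSpaces.
Context {R : realType}.
Implicit Types (X Y A B : metricType R) (D S T : set R).

(* The library allows empty metric spaces; metric spaces here are nonempty. *)
Definition nonempty_space X := [set: X] !=set0.

Definition ultrametric X :=
  forall x y z : X, mdist x z <= Num.max (mdist x y) (mdist y z).

Definition valued_in D X := forall x y : X, D (mdist x y).

Definition separable_space X := exists2 C : set X, countable C & dense C.

(* The axiom of completeType, without its requirement of a pointed type. *)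
Definition complete_space X :=
  forall F : set_system X, ProperFilter F -> cauchy F -> exists x : X, F --> x.

Definition isometric_embedding X Y (f : X -> Y) :=
  forall x y, mdist (f x) (f y) = mdist x y.

Definition isometric X Y :=
  exists2 f : X -> Y, isometric_embedding f & range f = [set: Y].

Definition finite_class D A :=
  [/\ nonempty_space A, finite_set [set: A], ultrametric A & valued_in D A].

Definition injective_space D X :=
  forall A B, finite_class D A -> finite_class D B ->
  forall (phi : A -> B) (psi : A -> X),
    isometric_embedding phi -> isometric_embedding psi ->
  exists2 theta : B -> X, isometric_embedding theta & theta \o phi = psi.

Definition countable_Urysohn D X :=
  [/\ nonempty_space X, ultrametric X & valued_in D X] /\
  [/\ separable_space X, complete_space X & injective_space D X].

Definition tenuous S :=
  S `<=` [set r | 0 <= r] /\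
  (finite_set S \/
   exists a : nat -> R,
     [/\ S = [set 0] `|` range a,
         forall i, 0 < a i,
         forall i j, (i < j)%N -> a j < a i &
         a @ \oo --> (0 : R)]).

Definition TEN D : set (set R) := [set S | [/\ tenuous S, S `<=` D & S 0]].

Definition setdist X (x : X) (P : set X) : R := inf [set mdist x a | a in P].

Definition petaloid D X :=
  [/\ nonempty_space X, ultrametric X & valued_in D X] /\
  exists Pi : set R -> set X,
    [/\ (* the subspace Pi S is isometric to the S-Urysohn universal space *)
        forall S, TEN D S -> exists V : metricType R,
          countable_Urysohn S V /\
          exists2 f : V -> X, isometric_embedding f & range f = Pi S,
        \bigcup_(S in TEN D) Pi S = [set: X],
        forall S T, TEN D S -> TEN D T -> Pi S `&` Pi T = Pi (S `&` T) &
        forall S T x, TEN D S -> TEN D T -> Pi T x ->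
          ((T `\` S) `|` [set 0]) (setdist x (Pi S))].

Definition Urysohn_universal D X :=
  (countable D /\ countable_Urysohn D X) \/ (~ countable D /\ petaloid D X).

(* The universal space is only determined up to isometry: being isometric to it
   means that one exists and that X is isometric to every one. *)
Definition isometric_to_Urysohn_universal D X :=
  (exists2 V : metricType R, Urysohn_universal D V & isometric X V) /\
  (forall V : metricType R, Urysohn_universal D V -> isometric X V).

End MetricSpaces.

Record valuation (R : realType) (K : fieldType) := Valuation {
  valuation_fun :> K -> \bar R;
  valuation_neqNy : forall x, valuation_fun x != -oo%E;
  valuation_eqy : forall x, valuation_fun x = +oo%E <-> x = 0;
  valuationM : forall x y,
    valuation_fun (x * y) = (valuation_fun x + valuation_fun y)%E;
  valuationD : forall x y,
    (Order.min (valuation_fun x) (valuation_fun y) <= valuation_fun (x + y)%R)%E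
}.

Section ValuationTheory.
Context {R : realType} {K : fieldType} (v : valuation R K).

Lemma valuation_fin x : x != 0 -> v x \is a fin_num.
Proof.
move=> x0; rewrite fin_numE valuation_neqNy /=.
by apply/eqP => /valuation_eqy/eqP; rewrite (negPf x0).
Qed.

Lemma valuation0 : v 0 = +oo%E. Proof. exact/valuation_eqy. Qed.

Lemma valuation1 : v 1 = 0%E.
Proof.
have := valuationM v 1 1; rewrite mulr1 -(fineK (valuation_fin (oner_neq0 K))).
by move=> [v11]; congr EFin; lra.
Qed.

Lemma valuationN x : v (- x) = v x.
Proof.
have vN1 : v (-1) = 0%E.
  have N1 : (-1 : K) != 0 by rewrite oppr_eq0 oner_neq0.
  have := valuationM v (-1) (-1); rewrite mulrNN mulr1 valuation1.
  rewrite -(fineK (valuation_fin N1)) => -[vN11]; congr EFin; lra.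
by rewrite -mulN1r valuationM vN1 add0e.
Qed.

Lemma valuation_geD (a : \bar R) x y :
  (a <= v x)%E -> (a <= v y)%E -> (a <= v (x + y)%R)%E.
Proof. by move=> ax ay; apply: le_trans (valuationD v x y); rewrite le_min ax. Qed.

Lemma valuation_gtD (a : \bar R) x y :
  (a < v x)%E -> (a < v y)%E -> (a < v (x + y)%R)%E.
Proof. by move=> ax ay; apply: lt_le_trans (valuationD v x y); rewrite lt_min ax. Qed.

Definition valuation_ring : {pred K} := fun x => (0 <= v x)%E.

Lemma valuation_ring_subring : subring_closed valuation_ring.
Proof.
split; rewrite /valuation_ring /in_mem /=; first by rewrite valuation1.
- by move=> x y x0 y0; apply: valuation_geD; rewrite ?valuationN.
- by move=> x y x0 y0; rewrite -?topredE /= valuationM adde_ge0.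
Qed.
HB.instance Definition _ :=
  GRing.isSubringClosed.Build K valuation_ring valuation_ring_subring.

Record valuation_integer := ValuationInteger {
  integer_val :> K;
  integer_valP : integer_val \in valuation_ring
}.
HB.instance Definition _ := [isSub for integer_val].
HB.instance Definition _ := [Choice of valuation_integer by <:].
HB.instance Definition _ :=
  [SubChoice_isSubComNzRing of valuation_integer by <:].

Definition maximal_ideal : {pred valuation_integer} :=
  fun x => (0 < v (val x))%E.

Lemma maximal_ideal_closed : idealr_closed maximal_ideal.
Proof.
split; rewrite /maximal_ideal /in_mem /=.
- by rewrite valuation0.
- by rewrite valuation1 ltxx.
- move=> a x y x0 y0; apply: valuation_gtD => //=.
  rewrite valuationM; apply: lt_le_trans x0 _.
  by apply: leeDr; exact: integer_valP.
Qed.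
HB.instance Definition _ :=
  isIdealr.Build valuation_integer maximal_ideal maximal_ideal_closed.

Definition residue_field := {ideal_quot maximal_ideal}.

End ValuationTheory.

(* eta ^ (- g) with the convention eta ^ (- oo) = 0; the value at g = -oo is
   never used. *)
Definition exp_opp {R : realType} (eta : R) (g : \bar R) : R :=
  if g is r%:E then eta `^ (- r) else 0.

Section ValuedMetric.
Context {R : realType} {K : fieldType} (v : valuation R K).
Variables (eta : R) (eta1 : 1 < eta).

Definition valued_dist (x y : K) : R := exp_opp eta (v (x - y)).

Lemma exp_opp_ge0 (g : \bar R) : 0 <= exp_opp eta g.
Proof. by case: g => [r| |] //=; exact: powR_ge0. Qed.

Lemma valued_distxx x : valued_dist x x = 0.
Proof. by rewrite /valued_dist subrr valuation0. Qed.

Lemma valued_dist_eq0 x y : valued_dist x y = 0 -> x = y.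
Proof.
move=> d0; apply/eqP; rewrite -subr_eq0; apply/negPn/negP => xy.
move: d0; rewrite /valued_dist -(fineK (valuation_fin v xy)) /= => /eqP.
by rewrite gt_eqF// powR_gt0// (lt_trans _ eta1).
Qed.

Lemma valued_distC x y : valued_dist x y = valued_dist y x.
Proof. by rewrite /valued_dist -opprB valuationN. Qed.

Lemma exp_opp_anti (g h : \bar R) : g != -oo%E -> (g <= h)%E ->
  exp_opp eta h <= exp_opp eta g.
Proof.
case: g h => [g| |] [h| |] //= _; last by move=> _; exact: powR_ge0.
by rewrite lee_fin => gh; rewrite ler_powR ?lerN2// ltW.
Qed.

Lemma valued_dist_ultra y x z :
  valued_dist x z <= Num.max (valued_dist x y) (valued_dist y z).
Proof.
rewrite /valued_dist -(subrKA y x (- z)) le_max.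
have := valuationD v (x - y) (y - z); rewrite ge_min.
by case/orP => /exp_opp_anti -> //; rewrite ?orbT ?valuation_neqNy.
Qed.

Lemma valued_dist_triangle y x z :
  valued_dist x z <= valued_dist x y + valued_dist y z.
Proof.
apply: le_trans (valued_dist_ultra y x z) _.
by rewrite ge_max lerDl lerDr !exp_opp_ge0.
Qed.

(* K with the metric eta ^ (- v (x - y)). *)
Definition valued_metric : Type := let _ := (v, eta1) in K.

HB.instance Definition _ := Choice.copy valued_metric K.
HB.instance Definition _ := isMetric.Build R valued_metric
  valued_distxx valued_dist_eq0 valued_distC valued_dist_triangle.

Lemma mdist_valuedE (x y : K) :
  mdist (x : valued_metric) (y : valued_metric) = exp_opp eta (v (x - y)).
Proof. by []. Qed.

End ValuedMetric.

Definition value_range_set (R : realType) (eta : R) (G : {pred R}) : set R :=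
  [set 0] `|` [set eta `^ (- g) | g in [set` G]].

(* Main.v *)
(* A separable ultrametric space takes only countably many distances, so the
   range set is countable here and the petaloid case does not occur.  Since the
   residue field is infinite, K realises every one-point extension of a finite
   subset, hence is injective; a back-and-forth argument along dense sequences
   then shows that two separable complete injective spaces are isometric. *)
Require Import Defs.
From HB Require Import structures.
From mathcomp Require Import all_boot all_order all_algebra ring_quotient lra.
From mathcomp Require Import all_classical all_reals all_analysis.

Set Implicit Arguments.
Unset Strict Implicit.
Unset Printing Implicit Defensive.

Import Order.TTheory GRing.Theory Num.Theory.

Local Open Scope classical_set_scope.
Local Open Scope ring_scope.

(** * Finite subsets as metric spaces *)

Section FiniteSubspaces.
Context {R : realType} {X : metricType R} (s : seq X).

Definition seq_sub_dist (x y : seq_sub s) : R := mdist (ssval x) (ssval y).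

Lemma seq_sub_distxx x : seq_sub_dist x x = 0.
Proof. exact: mdistxx. Qed.

Lemma seq_sub_dist_eq0 x y : seq_sub_dist x y = 0 -> x = y.
Proof. by move=> /mdist_positivity xy; exact: val_inj. Qed.

Lemma seq_sub_distC x y : seq_sub_dist x y = seq_sub_dist y x.
Proof. exact: metric_sym. Qed.

Lemma seq_sub_dist_triangle y x z :
  seq_sub_dist x z <= seq_sub_dist x y + seq_sub_dist y z.
Proof. exact: metric_triangle. Qed.

HB.instance Definition _ := isMetric.Build R (seq_sub s)
  seq_sub_distxx seq_sub_dist_eq0 seq_sub_distC seq_sub_dist_triangle.

Lemma finite_class_seq_sub (D : set R) (x : X) : x \in s ->
  ultrametric X -> valued_in D X -> finite_class D (seq_sub s).
Proof.
move=> xs uX DX; split.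
- by exists (SeqSub xs).
- exact: finite_finset.
- by move=> a b c; exact: uX.
- by move=> a b; exact: DX.
Qed.

End FiniteSubspaces.

(** * Finite partial isometries and their extension *)

Section PartialIsometries.
Context {R : realType}.

(** The list is the graph; it is single-valued and injective automatically, since points at distance
    0 coincide. *)
Definition partial_isometry {X Y : metricType R} (L : seq (X * Y)) :=
  {in L &, forall p q, mdist p.2 q.2 = mdist p.1 q.1}.

Lemma partial_isometry_cons {X Y : metricType R} (L : seq (X * Y)) x y :
  partial_isometry L -> {in L, forall p, mdist y p.2 = mdist x p.1} ->
  partial_isometry ((x, y) :: L).
Proof.
move=> isoL xyL p q; rewrite !inE => /predU1P[->|pL] /predU1P[->|qL] /=.
- by rewrite !mdistxx.
- exact: xyL.
- by rewrite metric_sym xyL// metric_sym.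
- exact: isoL.
Qed.

Lemma partial_isometry_swap {X Y : metricType R} (L : seq (X * Y)) :
  partial_isometry L -> partial_isometry [seq (p.2, p.1) | p <- L].
Proof.
by move=> isoL _ _ /mapP[p pL ->] /mapP[q qL ->] /=; rewrite isoL.
Qed.

(** Injectivity of [Y] is applied to the inclusion of the domain of [L] into that domain with [x]
    added; the partner of [x] is its image under the resulting embedding. *)
Lemma partial_isometry_extend (D : set R) {X Y : metricType R}
    (L : seq (X * Y)) (x : X) :
  ultrametric X -> valued_in D X -> nonempty_space Y -> injective_space D Y ->
  partial_isometry L -> exists y, partial_isometry ((x, y) :: L).
Proof.
(* The empty list is treated apart, because injectivity speaks of nonempty spaces only. *)
move=> uX DX [y0 _] injY isoL; have [->|] := eqVneq L [::].
  by exists y0 => p q; rewrite !inE => /eqP-> /eqP->; rewrite !mdistxx.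
move=> L0; have [p0 p0L] : exists p0, p0 \in L.
  by case: (L) L0 => // p L' _; exists p; rewrite mem_head.
pose s := [seq p.1 | p <- L].
have [x0 x0s] : exists x0, x0 \in s by exists p0.1; exact: map_f.
have /choice[psi psiP] (a : seq_sub s) : exists y, (ssval a, y) \in L.
  by have /mapP[[x1 y1] xyL ->] := ssvalP a; exists y1.
have sub a : a \in s -> a \in x :: s by rewrite inE orbC => ->.
pose phi (a : seq_sub s) : seq_sub (x :: s) := SeqSub (sub _ (ssvalP a)).
have phi_iso : isometric_embedding phi by [].
have psi_iso : isometric_embedding psi.
  by move=> a b; rewrite (isoL _ _ (psiP a) (psiP b)).
have [theta theta_iso thetaphi] := injY _ _ (finite_class_seq_sub x0s uX DX)
  (finite_class_seq_sub (mem_head x s) uX DX) _ _ phi_iso psi_iso.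
exists (theta (SeqSub (mem_head x s))); apply: partial_isometry_cons => //.
move=> p pL; have ps : p.1 \in s by exact: map_f.
have -> : p.2 = theta (phi (SeqSub ps)).
  have /= -> := congr1 (@^~ (SeqSub ps)) thetaphi.
  (* [psi] chose some partner of [p.1]; it is at distance 0 from [p.2]. *)
  by apply: mdist_positivity; rewrite (isoL _ _ pL (psiP _)) mdistxx.
by rewrite theta_iso.
Qed.

Lemma partial_isometry_back_and_forth (D : set R) {X Y : metricType R}
    (L : seq (X * Y)) (x : X) (y : Y) :
  countable_Urysohn D X -> countable_Urysohn D Y -> partial_isometry L ->
  exists L', [/\ partial_isometry L', {subset L <= L'},
    x \in [seq p.1 | p <- L'] & y \in [seq p.2 | p <- L']].
Proof.
move=> [[X0 uX DX] [_ _ injX]] [[Y0 uY DY] [_ _ injY]] isoL.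
have [y' isoL1] := partial_isometry_extend x uX DX Y0 injY isoL.
have [x' isoL2] := partial_isometry_extend y uY DY X0 injX
  (partial_isometry_swap isoL1).
exists ((x', y) :: (x, y') :: L); split.
- have := partial_isometry_swap isoL2.
  by rewrite /= -map_comp (eq_map (g := id)) ?map_id//; case.
- by move=> p pL; rewrite !inE pL !orbT.
- by rewrite !inE eqxx orbT.
- by rewrite !inE eqxx.
Qed.

End PartialIsometries.

(** * Dense sequences, and closures of isometric relations *)

Section Closure.
Context {R : realType}.

Lemma dense_mdist {X : metricType R} (C : set X) (x : X) (e : R) :
  dense C -> 0 < e -> exists2 c, C c & mdist x c < e.
Proof.
move=> dC e0; have xB : nbhs x (ball x e) by exact: nbhsx_ballx.
have [] := dC (ball x e)^°.
- by exists x; exact: xB.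
- exact: open_interior.
- by move=> c [/interior_subset]; rewrite ballEmdist => xc Cc; exists c.
Qed.

Lemma countable_enum {X : choiceType} (C : set X) : countable C -> C !=set0 ->
  exists u : nat -> X, forall x, C x -> exists n, u n = x.
Proof.
move=> /countable_injP[f finj] [x0 _].
exists (fun n => xget x0 [set x | C x /\ f x = n]) => x Cx; exists (f x).
have [Cy yx] : [set y | C y /\ f y = f x] (xget x0 [set y | C y /\ f y = f x]).
  exact: (@xgetI _ x0 _ x).
by apply: finj; rewrite ?inE.
Qed.

Lemma separable_enum {X : metricType R} :
  nonempty_space X -> separable_space X ->
  exists u : nat -> X, forall x e, 0 < e -> exists n, mdist x (u n) < e.
Proof.
move=> [x0 _] [C cC dC].
have [u uP] : exists u : nat -> X, forall x, C x -> exists n, u n = x.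
  apply: countable_enum => //.
  by have [c Cc _] := dense_mdist x0 dC ltr01; exists c.
exists u => x e e0; have [c /uP[n <-] xc] := dense_mdist x dC e0.
by exists n.
Qed.

Definition isometric_relation {X Y : metricType R} (Q : X -> Y -> Prop) :=
  forall x x' y y', Q x y -> Q x' y' -> mdist y y' = mdist x x'.

Definition relation_closure {X Y : metricType R} (Q : X -> Y -> Prop) x y :=
  forall e, 0 < e ->
    exists x' y', [/\ Q x' y', mdist x x' < e & mdist y y' < e].

Lemma relation_closure_isometric {X Y : metricType R} (Q : X -> Y -> Prop) :
  isometric_relation Q -> isometric_relation (relation_closure Q).
Proof.
move=> isoQ x1 x2 y1 y2 Q1 Q2; apply/eqP; rewrite -subr_eq0 -normr_le0.
apply/ler_addgt0Pl => e e0; rewrite addr0.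
(* Passing to the approximating pairs moves four points, each by less than [e / 4]. *)
have e4 : 0 < e / 4%:R by rewrite divr_gt0.
have [a1 [b1 [ab1 xa1 yb1]]] := Q1 _ e4.
have [a2 [b2 [ab2 xa2 yb2]]] := Q2 _ e4.
have dab := isoQ _ _ _ _ ab1 ab2.
have quad (Z : metricType R) (p1 p2 q1 q2 : Z) :
    mdist p1 p2 <= mdist p1 q1 + mdist q1 q2 + mdist p2 q2.
  apply: le_trans (metric_triangle p1 q1 p2) _; rewrite -addrA lerD2l.
  by rewrite (metric_sym p2 q2); exact: metric_triangle.
have := quad _ x1 x2 a1 a2; have := quad _ a1 a2 x1 x2.
have := quad _ y1 y2 b1 b2; have := quad _ b1 b2 y1 y2.
rewrite (metric_sym b1 y1) (metric_sym b2 y2) (metric_sym a1 x1).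
rewrite (metric_sym a2 x2) ler_norml.
lra.
Qed.

(** As [Q] preserves distances, the partners of points ever closer to [x] generate a Cauchy filter;
    its limit is a partner of [x] in the closure. *)
Lemma relation_closure_total {X Y : metricType R} (Q : X -> Y -> Prop) :
  complete_space Y -> isometric_relation Q ->
  (forall x e, 0 < e -> exists x' y', Q x' y' /\ mdist x x' < e) ->
  forall x, exists y, relation_closure Q x y.
Proof.
move=> cY isoQ dQ x.
pose B e := [set y | exists2 x', Q x' y & mdist x x' < e].
pose F : set_system Y := filter_from [set e | 0 < e] B.
have FF : ProperFilter F.
  apply: filter_from_proper; last first.
    by move=> e /(dQ x)[x' [y [Qxy xx']]]; exists y, x'.
  apply: filter_from_filter; first by exists 1; exact: ltr01.
  move=> e1 e2 /= e10 e20; exists (Num.min e1 e2); first by rewrite lt_min e10.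
  by move=> y [x' Qxy]; rewrite lt_min => /andP[? ?]; split; exists x'.
have cF : cauchy F.
  apply/cauchy_ballP => e e0.
  have Be : F (B (e / 2)) by exists (e / 2) => //=; rewrite divr_gt0.
  exists (B (e / 2), B (e / 2)) => //= -[y1 y2] /= [[x1 Q1 d1] [x2 Q2 d2]].
  rewrite ballEmdist /= (isoQ _ _ _ _ Q1 Q2).
  apply: le_lt_trans (metric_triangle x1 x x2) _.
  by rewrite (splitr e) ltrD// metric_sym.
have [y Fy] := cY F FF cF; exists y => e e0.
have : F (B e `&` ball y e).
  apply: filterI; first by exists e.
  by apply: Fy; exact: nbhsx_ballx.
move=> /filter_ex[y' [[x' Qxy xx']]]; rewrite ballEmdist => yy'.
by exists x', y'.
Qed.

Lemma isometric_of_relation {X Y : metricType R} (Q : X -> Y -> Prop) :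
  complete_space X -> complete_space Y -> isometric_relation Q ->
  (forall x e, 0 < e -> exists x' y', Q x' y' /\ mdist x x' < e) ->
  (forall y e, 0 < e -> exists x' y', Q x' y' /\ mdist y y' < e) ->
  isometric X Y.
Proof.
move=> cX cY isoQ dX dY.
have isoC := relation_closure_isometric isoQ.
have /choice[f fP] := relation_closure_total cY isoQ dX.
exists f; first by move=> x y; exact: isoC.
apply/seteqP; split=> // y _.
(* Surjectivity is totality of the closure of the converse relation. *)
have isoQ' : isometric_relation (fun y x => Q x y).
  by move=> ? ? ? ? /isoQ h /h.
have dY' z e : 0 < e -> exists y' x', Q x' y' /\ mdist z y' < e.
  by move=> /(dY z)[x' [y' ?]]; exists y', x'.
have [x yx] := relation_closure_total cX isoQ' dY' y.
have {}yx : relation_closure Q x y.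
  by move=> e /yx[y' [x' [? ? ?]]]; exists x', y'.
exists x => //; apply: mdist_positivity.
by rewrite (isoC _ _ _ _ (fP x) yx) mdistxx.
Qed.

End Closure.

(** An increasing chain of finite partial isometries absorbs both dense sequences; its union is an
    isometric relation with dense domain and range. *)
Lemma countable_Urysohn_unique (R : realType) (D : set R) (X Y : metricType R) :
  countable_Urysohn D X -> countable_Urysohn D Y -> isometric X Y.
Proof.
move=> UX UY; have [[X0 _ _] [sX cX _]] := UX; have [[Y0 _ _] [sY cY _]] := UY.
have [u uP] := separable_enum X0 sX; have [w wP] := separable_enum Y0 sY.
pose good (L : seq (X * Y)) n L' := partial_isometry L -> [/\ partial_isometry L',
  {subset L <= L'}, u n \in [seq p.1 | p <- L'] & w n \in [seq p.2 | p <- L']].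
have /choice[ext extP] (Ln : seq (X * Y) * nat) : exists L', good Ln.1 Ln.2 L'.
  (* The choice function must be total; lists that are not partial isometries get the junk value
     [[::]]. *)
  have [isoL|niso] := pselect (partial_isometry Ln.1); last by exists [::].
  have [L' ?] :=
    partial_isometry_back_and_forth (u Ln.2) (w Ln.2) UX UY isoL.
  by exists L'.
pose fix L n := if n is n'.+1 then ext (L n', n') else [::].
have isoL n : partial_isometry (L n).
  by elim: n => [//|n IH]; have [] := extP (L n, n) IH.
have subL m n : (m <= n)%N -> {subset L m <= L n}.
  elim: n => [|n IH]; first by rewrite leqn0 => /eqP->.
  rewrite leq_eqVlt => /predU1P[->//|/IH mn] p /mn pn.
  by have [_ sub _ _] := extP (L n, n) (isoL n); exact: sub.
pose Q x y := exists n, (x, y) \in L n.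
apply: (@isometric_of_relation _ _ _ Q) => //.
- move=> x x' y y' [m mL] [n nL].
  exact: (isoL (maxn m n) _ _ (subL _ _ (leq_maxl m n) _ mL)
    (subL _ _ (leq_maxr m n) _ nL)).
- move=> x e /(uP x)[n xn].
  have [_ _ /mapP[[a b] abL /= ?] _] := extP (L n, n) (isoL n); subst a.
  (* [L 0] is empty, so [u n] and [w n] enter at stage [n.+1]. *)
  by exists (u n), b; split => //; exists n.+1.
- move=> y e /(wP y)[n yn].
  have [_ _ _ /mapP[[a b] abL /= ?]] := extP (L n, n) (isoL n); subst b.
  by exists a, (w n); split => //; exists n.+1.
Qed.

(** * Distances in ultrametric spaces, and one-point extensions *)

Section Ultrametric.
Context {R : realType}.

Lemma ultrametric_isosceles (X : metricType R) (x y z : X) :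
  ultrametric X -> mdist x y < mdist y z -> mdist x z = mdist y z.
Proof.
move=> uX xy; apply/eqP; rewrite eq_le; apply/andP; split.
  by apply: le_trans (uX x y z) _; rewrite ge_max lexx ltW.
have := uX y x z; rewrite le_max (metric_sym y x) => /orP[yz|//].
by have := le_lt_trans yz xy; rewrite ltxx.
Qed.

(** Moving each endpoint by less than [mdist x y] does not change the distance, so every nonzero
    distance already occurs between points of the countable dense set. *)
Lemma countable_distances (X : metricType R) :
  ultrametric X -> separable_space X ->
  countable [set mdist p.1 p.2 | p in [set: X * X]].
Proof.
move=> uX [C cC dC].
have cD : countable [set mdist p.1 p.2 | p in C `*` C].
  by apply: sub_countable (card_image_le _ _) _; exact: countableX.
apply: sub_countable cD; apply: subset_card_le => _ [[x y] _ <-] /=.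
have [<-|xy] := eqVneq x y.
  have [c Cc _] := dense_mdist x dC ltr01.
  by exists (c, c) => //=; rewrite !mdistxx.
have xy0 : 0 < mdist x y by rewrite mdist_gt0.
have [c Cc xc] := dense_mdist x dC xy0.
have [c' Cc' yc'] := dense_mdist y dC xy0.
exists (c, c') => //=; rewrite metric_sym in xc.
have cy := ultrametric_isosceles uX xc.
rewrite (metric_sym y c') -cy (metric_sym c y) in yc'.
by rewrite /= metric_sym (ultrametric_isosceles uX yc') metric_sym.
Qed.

Lemma seq_minimizer (T : eqType) (f : T -> R) (s : seq T) : s != [::] ->
  exists2 x, x \in s & {in s, forall y, f x <= f y}.
Proof.
elim: s => // a s IH _; have [->|/IH[x xs xP]] := eqVneq s [::].
  by exists a; rewrite ?mem_head// => y; rewrite inE => /eqP->.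
have [ax|xa] := leP (f a) (f x).
  exists a; first exact: mem_head.
  by move=> y /predU1P[->//|/xP]; exact: le_trans.
exists x; first by rewrite inE xs orbT.
by move=> y /predU1P[->|/xP//]; exact: ltW.
Qed.

(** The finite subspace is a list in [B], and the partial embedding a total map constrained on that
    list only, so that induction needs no new metric spaces. *)
Definition one_point_extensions (D : set R) (X : metricType R) :=
  forall (B : metricType R) (s : seq B) (p : B -> X) (b : B),
  ultrametric B -> valued_in D B -> b \notin s ->
  {in s &, forall x y, mdist (p x) (p y) = mdist x y} ->
  exists z, {in s, forall x, mdist z (p x) = mdist b x}.

(** Induction on an enumeration of [B], starting from the image of [phi] and adding one point at a
    time. *)
Lemma injective_of_one_point (D : set R) (X : metricType R) :
  one_point_extensions D X -> injective_space D X.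
Proof.
move=> ext A B [[a0 _] /finite_seqP[sA sAP] _ _] [_ /finite_seqP[sB sBP] uB DB].
move=> phi psi phi_iso psi_iso.
have inA a : a \in sA by have : [set: A] a by []; rewrite sAP.
have inB b : b \in sB by have : [set: B] b by []; rewrite sBP.
pose T s := [seq phi a | a <- sA] ++ s.
have [theta [theta_iso thetaphi]] : exists theta : B -> X,
    {in T sB &, forall x y, mdist (theta x) (theta y) = mdist x y} /\
    theta \o phi = psi.
  elim: {inB sBP} sB => [|b s [theta [theta_iso thetaphi]]].
    have /choice[theta thetaP] b : exists x,
        forall a, phi a = b -> x = psi a.
      have [[a ab]|nab] := pselect (exists a, phi a = b); last first.
        by exists (psi a0) => a ab; case: nab; exists a.
      (* Independent of the preimage: [phi] and [psi] preserve distances, so equal images under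
         [phi] have equal images under [psi]. *)
      exists (psi a) => a' a'b; apply: mdist_positivity.
      by rewrite psi_iso -phi_iso ab a'b mdistxx.
    exists theta; split; last by apply/funext => a /=; rewrite (thetaP _ a).
    move=> x y; rewrite /T cats0 => /mapP[a _ ->] /mapP[a' _ ->].
    by rewrite (thetaP _ a)// (thetaP _ a')// psi_iso phi_iso.
  have TE x : (x \in T (b :: s)) = (x == b) || (x \in T s).
    by rewrite !mem_cat inE orbCA.
  have [bT|bT] := boolP (b \in T s).
    have TE' x : x \in T (b :: s) -> x \in T s.
      by rewrite TE => /predU1P[->|].
    by exists theta; split=> // x y /TE' ? /TE' ?; exact: theta_iso.
  have [z zP] := ext B (T s) theta b uB DB bT theta_iso.
  (* Changing the value at [b] preserves [theta \o phi = psi], as [b] is not in the image of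
     [phi]. *)
  exists (fun x => if x == b then z else theta x); split.
    move=> x y; rewrite !TE.
    have [->|xb] := eqVneq x b; have [->|yb] := eqVneq y b => //= xT yT.
    - by rewrite !mdistxx.
    - exact: zP.
    - by rewrite metric_sym zP// metric_sym.
    - exact: theta_iso.
  apply/funext => a /=; rewrite -thetaphi; case: eqP => //= ab.
  by move: bT; rewrite -ab mem_cat map_f.
by exists theta => // x y; apply: theta_iso; rewrite mem_cat inB orbT.
Qed.

End Ultrametric.

(** * The valued field: its range set and its one-point extensions *)

Section ValuedField.
Context {R : realType} {eta : R} (eta1 : 1 < eta) {K : fieldType}.
Variable v : valuation R K.

Lemma ultrametric_valued : ultrametric (valued_metric v eta1).
Proof. by move=> x y z; exact: valued_dist_ultra. Qed.

(** Finitely many classes do not exhaust the residue field; an integer [u] of another class differs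
    from each [w] by a unit. *)
Lemma residue_avoid (s : seq (valuation_integer v)) :
  infinite_set [set: residue_field v] ->
  exists u : valuation_integer v,
    {in s, forall w, v (val u - val w) = 0%E}.
Proof.
move=> kinf.
have [q [_ qs]] : ([set: residue_field v] `\`
    [set` [seq (\pi_(residue_field v) w)%qT | w <- s]]) !=set0.
  by apply: infinite_setN0; apply: infinite_setD => //; exact: finite_seq.
exists (repr q) => w ws.
have : repr q - w \notin @maximal_ideal R K v.
  rewrite Quotient.idealrBE reprK; apply: contra_notN qs => /eqP qw.
  by apply/mapP; exists w.
rewrite /maximal_ideal -topredE /= -leNgt => le0.
apply/eqP; rewrite eq_le le0 /=.
exact: (integer_valP (repr q - w)).
Qed.

Context (G : zmodClosed R).
Hypothesis vG : v @` [set x | x != 0] = EFin @` [set` G].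

Lemma value_range_setP (r : R) : value_range_set eta G r <->
  exists x : K, r = exp_opp eta (v x).
Proof.
split=> [[->|[g gG <-]]|[x ->]].
- by exists 0; rewrite valuation0.
- have : (EFin @` [set` G]) g%:E by exists g.
  by rewrite -vG => -[x _ vx]; exists x; rewrite vx.
- have [->|x0] := eqVneq x 0; first by left; rewrite valuation0.
  have : (v @` [set x | x != 0]) (v x) by exists x.
  by rewrite vG => -[g gG vx]; right; exists g; rewrite // -vx.
Qed.

Lemma valued_in_valued :
  valued_in (value_range_set eta G) (valued_metric v eta1).
Proof. by move=> x y; apply/value_range_setP; exists (x - y). Qed.

(** Every value is a distance to 0; this transfers countability from the distances to the range
    set. *)
Lemma value_range_distances : value_range_set eta G =
  [set mdist p.1 p.2 | p in [set: valued_metric v eta1 * valued_metric v eta1]].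
Proof.
apply/seteqP; split=> r.
  move=> /value_range_setP[x ->].
  by exists (x, 0) => //=; rewrite mdist_valuedE subr0.
by move=> [[x y] _ <-]; exact: valued_in_valued.
Qed.

(* With [t] of valuation [g] where [eta ^ (- g)] is the distance [r] from the
   new point to the closest old one [a0], the old points within [r] of [a0] are
   the [a0 + t w] with [w] integral; take [a0 + t u] where the residue of [u]
   differs from those of all these [w]. *)
Lemma one_point_extensions_valued :
  infinite_set [set: residue_field v] ->
  one_point_extensions (value_range_set eta G) (valued_metric v eta1).
Proof.
move=> kinf B s p b uB DB bs p_iso.
have [->|s0] := eqVneq s [::]; first by exists (0 : K).
have [t0 t0s t0P] := seq_minimizer (fun x => mdist b x) s0.
have r0 : 0 < mdist b t0.
  by rewrite mdist_gt0; apply: contraNneq bs => ->.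
have /value_range_setP[t rt] := DB b t0.
have tn0 : t != 0 by apply: contraTneq r0 => t_0; rewrite rt t_0 valuation0 ltxx.
pose a0 : K := p t0.
(* The default 0 is taken only when the quotient is not integral, which [wE] excludes for the points
   it concerns. *)
pose w x : valuation_integer v := insubd 0 (((p x : K) - a0) / t).
have [u uP] := residue_avoid (map w s) kinf.
exists (a0 + t * val u : K).
have vt := fineK (valuation_fin v tn0).
have wE x : x \in s -> mdist x t0 <= mdist b t0 ->
    (p x : K) = a0 + t * val (w x).
  move=> xs; rewrite -(p_iso _ _ xs t0s) rt mdist_valuedE => le_r.
  have wI : ((p x : K) - a0) / t \in valuation_ring v.
    rewrite /valuation_ring -topredE /=.
    have [->|pxa] := eqVneq ((p x : K) - a0) 0.
      by rewrite mul0r valuation0 leey.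
    rewrite valuationM.
    have vpx := fineK (valuation_fin v pxa).
    have tV0 : t^-1 != 0 by rewrite invr_eq0.
    have vtV := fineK (valuation_fin v tV0).
    have := valuationM v t t^-1; rewrite divff// valuation1 -vt -vtV => -[vV].
    move: le_r; rewrite -/a0 -vpx -vt /= lee_fin leNgt => /negP le_r.
    rewrite leNgt; apply/negP => lt0; apply: le_r.
    (* Powers of [eta] are [expR (_ * ln eta)] with [ln eta] positive, so comparing them amounts to
       comparing exponents. *)
    rewrite /powR gt_eqF ?(lt_trans _ eta1)// ltr_expR ltr_pM2r ?ln_gt0//.
    lra.
  by rewrite val_insubd wI mulrC divfK// addrC subrK.
(* The distance is given by [t * (u - w y)], whose valuation is that of [t] because [u - w y] is a
   unit. *)
have near_r y : y \in s -> mdist y t0 <= mdist b t0 ->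
    mdist (a0 + t * val u : valued_metric v eta1) (p y) = mdist b t0.
  move=> ys /wE -> //; rewrite mdist_valuedE rt opprD addrACA subrr add0r.
  by rewrite -mulrBr valuationM uP ?adde0// map_f.
move=> x xs; have [le_r|lt_r] := leP (mdist x t0) (mdist b t0).
  (* For [x] near [t0], minimality of [t0] and the ultrametric inequality force
     [mdist b x = mdist b t0]. *)
  rewrite near_r//; apply/eqP; rewrite eq_le t0P//=.
  apply: le_trans (uB b t0 x) _.
  by rewrite ge_max lexx metric_sym.
have zt0 : mdist (a0 + t * val u : valued_metric v eta1) (p t0) = mdist b t0.
  by apply: near_r => //; rewrite mdistxx mdist_ge0.
(* For [x] far from [t0], both [b] and the new point are closer to the base point than [x] is, so
   both distances equal [mdist t0 x]. *)
rewrite (metric_sym x) in lt_r.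
rewrite (ultrametric_isosceles uB lt_r).
rewrite -(p_iso _ _ t0s xs) in lt_r *.
apply: ultrametric_isosceles; first exact: ultrametric_valued.
by rewrite zt0.
Qed.

End ValuedField.

Lemma countable_Urysohn_valued (R : realType) (eta : R) (eta1 : 1 < eta)
    (G : zmodClosed R) (K : fieldType) (v : valuation R K) :
  separable_space (valued_metric v eta1) ->
  complete_space (valued_metric v eta1) ->
  v @` [set x | x != 0] = EFin @` [set` G] ->
  infinite_set [set: residue_field v] ->
  countable_Urysohn (value_range_set eta G) (valued_metric v eta1).
Proof.
move=> Ksep Kcomp vG kinf; split; split=> //.
- by exists (0 : K).
- exact: ultrametric_valued.
- exact: valued_in_valued.
- exact/injective_of_one_point/one_point_extensions_valued.
Qed.

Theorem theorem4p3 (R : realType) (eta : R) (eta1 : 1 < eta)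
    (G : zmodClosed R) (ZG : forall n : int, n%:~R \in G)
    (K : fieldType) (v : valuation R K)
    (Ksep : separable_space (valued_metric v eta1))
    (Kcomp : complete_space (valued_metric v eta1))
    (vG : v @` [set x | x != 0] = EFin @` [set` G])
    (kinf : infinite_set [set: residue_field v]) :
  isometric_to_Urysohn_universal (value_range_set eta G)
    (valued_metric v eta1).
Proof.
have cD : countable (value_range_set eta G).
  rewrite (value_range_distances eta1 vG).
  exact: (countable_distances (@ultrametric_valued _ _ eta1 _ v) Ksep).
have UK := countable_Urysohn_valued Ksep Kcomp vG kinf.
have unique V : Urysohn_universal (value_range_set eta G) V ->
    isometric (valued_metric v eta1) V.
  by move=> [[_ UV]|[/(_ cD)]//]; exact: countable_Urysohn_unique UK UV.
(* The field itself serves as the universal space whose existence is required. *)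
split=> //; exists (valued_metric v eta1); first by left.
by apply: unique; left.
Qed.
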